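(* Let $P\in\mathbb{C}[x,y]$ have no zeros in $\mathbb{R}\times\mathbb{H}$ and no factors in common with $\bar P$, let $M=\mathrm{Ord}(P(0,y))$, and normalize $P$ so that the coefficient of $y^M$ in $P(0,y)$ is real. Let $(2L_j,q_j)$, $j=1,\dots,M$, be the data from the factorization of $P$ described in the context, and let $A=\tfrac12(P+\bar P)$, $B=\tfrac1{2i}(P-\bar P)$. Then for all but finitely many $t\in\mathbb{R}$ there is a local factorization $$A(x,y)+tB(x,y)=u(x,y;t)\prod_{j=1}^{M}\bigl(y+q_j(x)+x^{2L_j}\psi_j(x;t)\bigr)$$ where, for each fixed such $t$, $u(\cdot,\cdot;t)\in\mathbb{C}\{x,y\}$ is a unit and $\psi_j(\cdot;t)\in\mathbb{R}\{x\}$, and moreover for all $i\neq j$, $$\mathrm{Ord}\bigl(q_j(x)-q_i(x)+x^{2L_j}\psi_j(x;t)-x^{2L_i}\psi_i(x;t)\bigr)=O_{ij}.$$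
   Context: $\mathbb{H}=\{\operatorname{Im}z>0\}$; $\bar P(x,y)=\overline{P(\bar x,\bar y)}$. $\mathbb{C}\{x,y\}$ denotes convergent power series at the origin, $\mathbb{R}\{x\}$ those in $x$ with real coefficients; a unit is a series nonvanishing at the origin; Ord is order of vanishing at $0$. For such $P$ one has (locally) $P=u\prod_{j=1}^M(y+q_j(x)+x^{2L_j}\psi_j(x^{1/k}))$ with $u$ a unit, $k\ge1$, $L_j\in\mathbb{N}$, $q_j\in\mathbb{R}[x]$, $q_j(0)=0$, $\deg q_j<2L_j$, $\psi_j\in\mathbb{C}\{x\}$, $\operatorname{Im}\psi_j(0)>0$; the pairs $(2L_j,q_j)$ are these data. $O_{ij}=\min\{\mathrm{Ord}(q_j-q_i),2L_j,2L_i\}$. *)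

(* Defs.v *)
(* R : realType (from mathcomp-reals, a real closed field),
   C := R[i] from mathcomp-real-closed.  Convergent power series are
   represented by their coefficient families together with a convergence
   (geometric bound) predicate; identities in C{x,y} are identities of
   coefficient families under the (finite) Cauchy product. *)
From HB Require Import structures.
From mathcomp Require Import all_boot all_order all_algebra.
From mathcomp Require Import reals complex.
Set Implicit Arguments. Unset Strict Implicit. Unset Printing Implicit Defensive.
Import Order.TTheory GRing.Theory Num.Theory.
Local Open Scope ring_scope.

Section Series.
Variable R : realType.
Local Notation C := R[i].

(* formal power series in one variable x: coefficient of x^m *)
Definition ser1 (K : Type) := nat -> K.
(* formal power series in (x,y): coefficient of x^m y^n *)
Definition ser2 := nat -> nat -> C.

Definition conv1 (a : ser1 C) : Prop :=
  exists r K : R, 0 < r /\ forall m, `|a m| * (r%:C)%C ^+ m <= (K%:C)%C.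
Definition conv1R (a : ser1 R) : Prop :=
  exists r K : R, 0 < r /\ forall m, `|a m| * r ^+ m <= K.
Definition conv2 (a : ser2) : Prop :=
  exists r K : R, 0 < r /\ forall m n, `|a m n| * (r%:C)%C ^+ (m + n) <= (K%:C)%C.

Definition unit2 (u : ser2) : Prop := conv2 u /\ u 0%N 0%N != 0.

Definition mulS (f g : ser2) : ser2 := fun m n =>
  \sum_(i < m.+1) \sum_(j < n.+1) f i j * g (m - i)%N (n - j)%N.
Definition oneS : ser2 := fun m n => ((m == 0%N) && (n == 0%N))%:R.

Definition lin1 (h : ser1 C) : ser2 := fun m n =>
  if n == 1%N then (m == 0%N)%:R else if n == 0%N then h m else 0.

Definition shiftS (K : zmodType) (d : nat) (h : ser1 K) : ser1 K :=
  fun m => if (d <= m)%N then h (m - d)%N else 0.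
Definition substk1 (K : zmodType) (k : nat) (h : ser1 K) : ser1 K :=
  fun m => if (k %| m)%N then h (m %/ k)%N else 0.
Definition substk2 (k : nat) (f : ser2) : ser2 :=
  fun m n => if (k %| m)%N then f (m %/ k)%N n else 0.

Definition addS1 (K : zmodType) (a b : ser1 K) : ser1 K := fun m => a m + b m.

Definition realS (a : ser1 R) : ser1 C := fun m => ((a m)%:C)%C.
Definition polyS1 (q : {poly R}) : ser1 C := fun m => ((q`_m)%:C)%C.

(* P in C[x,y] is represented as P : {poly {poly C}}, P = sum_n P`_n(x) y^n *)
Definition polyS2 (P : {poly {poly C}}) : ser2 := fun m n => (P`_n)`_m.
Definition eval2 (P : {poly {poly C}}) (a b : C) : C :=
  (map_poly (fun p : {poly C} => p.[a]) P).[b].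
(* \bar P (x,y) = conj (P (conj x, conj y)) *)
Definition conjP (P : {poly {poly C}}) : {poly {poly C}} :=
  map_poly (map_poly (@conjc R)) P.
Definition cstP (c : C) : {poly {poly C}} := c%:P%:P.
Definition Apart (P : {poly {poly C}}) := cstP (2^-1) * (P + conjP P).
Definition Bpart (P : {poly {poly C}}) := cstP ((2 * 'i%C)^-1) * (P - conjP P).

Definition has_order (K : zmodType) (a : ser1 K) (n : nat) : Prop :=
  (forall m, (m < n)%N -> a m = 0) /\ a n != 0.

(* Ord of a polynomial (meaningful for q != 0) *)
Definition ordp (K : nzRingType) (q : {poly K}) : nat := find (fun c => c != 0) q.

(* O_ij = min {Ord(q_j - q_i), 2L_j, 2L_i}, with Ord 0 = +oo *)
Definition Oij (qi qj : {poly R}) (Li Lj : nat) : nat :=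
  if qj - qi == 0 then minn (2 * Lj) (2 * Li)
  else minn (ordp (qj - qi)) (minn (2 * Lj) (2 * Li)).

End Series.

(* Main.v *)
Require Import Defs.
From HB Require Import structures.
From mathcomp Require Import all_boot all_order all_algebra.
From mathcomp Require Import reals complex.
From mathcomp Require Import separable boolp.
From mathcomp Require Import ring lra zify.
Import Order.TTheory GRing.Theory Num.Theory.
Set Implicit Arguments. Unset Strict Implicit. Unset Printing Implicit Defensive.
Local Open Scope ring_scope.

(* [A + t B] is the real part of [(1 - i t) P].  Along [y = - q_i(x) - z x^(2 L_i)],
   with [z] real, the j-th factor of [P] has order [O_ij], and its lowest coefficient
   is [psi_j(0) - z] if [(L_j, q_j) = (L_i, q_i)], a real number minus [z] if [q_j]
   refines [q_i] to a higher order, and a nonzero constant otherwise.  So the lowest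
   coefficient of [P] is [c H(z) g(z)], where [H] has its roots in the upper half
   plane and [g] is real with real roots, and that of [A + t B] is
   [g(z) Re((1 - i t) c H(z))].  By the Hermite-Biehler theorem the second factor has
   [deg H] distinct real roots, which avoid those of [g] for all but finitely many
   [t].  Being simple, they lift by Hensel's lemma to convergent real series
   [psi_j(x; t)].  This produces [M] distinct power series roots of [A + t B]; dividing
   them out leaves a unit because the order in [y] is [M], and the contact orders are
   read off from the numbers [psi_j(0; t)]. *)

(** * Formal power series *)

Record fps (K : Type) := Fps { fcoef :> nat -> K }.

Lemma fpsP (K : Type) (f g : fps K) : (forall m, f m = g m) -> f = g.
Proof. by case: f g => [f] [g] /= fg; congr Fps; exact/funext. Qed.

HB.instance Definition _ (K : Type) := gen_eqMixin (fps K).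
HB.instance Definition _ (K : Type) := gen_choiceMixin (fps K).

Section FpsRing.
Variable K : comNzRingType.
Implicit Types f g h : fps K.

Definition fps_zero : fps K := Fps (fun=> 0).
Definition fps_one : fps K := Fps (fun m => (m == 0%N)%:R).
Definition fps_opp f : fps K := Fps (fun m => - f m).
Definition fps_add f g : fps K := Fps (fun m => f m + g m).
Definition fps_mul f g : fps K :=
  Fps (fun m => \sum_(i < m.+1) f i * g (m - i)%N).

Definition fps_trunc n f : {poly K} := \poly_(i < n) f i.

Lemma coef_fps_trunc n f m : (m < n)%N -> (fps_trunc n f)`_m = f m.
Proof. by rewrite coef_poly => ->. Qed.

Lemma coefM_low n (p p' r r' : {poly K}) :
  (forall i, (i < n)%N -> p`_i = p'`_i) -> (forall i, (i < n)%N -> r`_i = r'`_i) ->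
  forall i, (i < n)%N -> (p * r)`_i = (p' * r')`_i.
Proof.
move=> pp' rr' i i_n; rewrite !coefM; apply: eq_bigr => j _.
by rewrite pp' ?rr' //; have := ltn_ord j; lia.
Qed.

Lemma fps_mul_trunc n f g m : (m < n)%N ->
  fps_mul f g m = (fps_trunc n f * fps_trunc n g)`_m.
Proof.
move=> mn; rewrite coefM; apply: eq_bigr => i _.
by rewrite !coef_fps_trunc //; have := ltn_ord i; lia.
Qed.

Fact fps_addA : associative fps_add.
Proof. by move=> f g h; apply: fpsP => m /=; rewrite addrA. Qed.
Fact fps_addC : commutative fps_add.
Proof. by move=> f g; apply: fpsP => m /=; rewrite addrC. Qed.
Fact fps_add0 : left_id fps_zero fps_add.
Proof. by move=> f; apply: fpsP => m /=; rewrite add0r. Qed.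
Fact fps_addN : left_inverse fps_zero fps_opp fps_add.
Proof. by move=> f; apply: fpsP => m /=; rewrite addNr. Qed.

HB.instance Definition _ :=
  GRing.isZmodule.Build (fps K) fps_addA fps_addC fps_add0 fps_addN.

Fact fps_mulC : commutative fps_mul.
Proof.
by move=> f g; apply: fpsP => m; rewrite !(@fps_mul_trunc m.+1) // mulrC.
Qed.

Fact fps_mulA : associative fps_mul.
Proof.
move=> f g h; apply: fpsP => m; rewrite !(@fps_mul_trunc m.+1) //.
have trunc_mul u v i : (i < m.+1)%N ->
    (fps_trunc m.+1 (fps_mul u v))`_i = (fps_trunc m.+1 u * fps_trunc m.+1 v)`_i.
  by move=> im; rewrite coef_fps_trunc // (@fps_mul_trunc m.+1).
rewrite (coefM_low (fun i _ => erefl) (trunc_mul g h)) // mulrA.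
by apply/esym; apply: (coefM_low (trunc_mul f g)).
Qed.

Fact fps_mul1 : left_id fps_one fps_mul.
Proof.
move=> f; apply: fpsP => m /=; rewrite big_ord_recl /= mul1r subn0.
by rewrite big1 ?addr0 // => i _; rewrite mul0r.
Qed.

Fact fps_mulDl : left_distributive fps_mul fps_add.
Proof.
move=> f g h; apply: fpsP => m /=; rewrite -big_split /=.
by apply: eq_bigr => i _; rewrite mulrDl.
Qed.

Fact fps_one_neq0 : fps_one != 0.
Proof. by apply/eqP => /(congr1 (fun f : fps K => f 0%N)) /eqP; rewrite oner_eq0. Qed.

HB.instance Definition _ := GRing.Zmodule_isComNzRing.Build (fps K)
  fps_mulA fps_mulC fps_mul1 fps_mulDl fps_one_neq0.

Lemma fps1E m : (1 : fps K) m = (m == 0%N)%:R. Proof. by []. Qed.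
Lemma fpsDE f g m : (f + g) m = f m + g m. Proof. by []. Qed.
Lemma fpsNE f m : (- f) m = - f m. Proof. by []. Qed.
Lemma fpsBE f g m : (f - g) m = f m - g m. Proof. by []. Qed.
Lemma fpsME f g m : (f * g) m = \sum_(i < m.+1) f i * g (m - i)%N.
Proof. by []. Qed.

Lemma fps_sumE (I : Type) (r : seq I) (P : pred I) (F : I -> fps K) m :
  (\sum_(i <- r | P i) F i) m = \sum_(i <- r | P i) F i m.
Proof. by apply: (big_morph (fun f : fps K => f m)). Qed.

Definition fps_poly (p : {poly K}) : fps K := Fps (fun m => p`_m).

Fact fps_poly_is_zmod_morphism : zmod_morphism fps_poly.
Proof. by move=> p r; apply: fpsP => m /=; rewrite coefB. Qed.
Fact fps_poly_is_monoid_morphism : monoid_morphism fps_poly.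
Proof.
split; first by apply: fpsP => m; rewrite fps1E /= coef1.
by move=> p r; apply: fpsP => m; rewrite fpsME /= coefM.
Qed.
HB.instance Definition _ := GRing.isZmodMorphism.Build {poly K} (fps K)
  fps_poly fps_poly_is_zmod_morphism.
HB.instance Definition _ := GRing.isMonoidMorphism.Build {poly K} (fps K)
  fps_poly fps_poly_is_monoid_morphism.

Definition fps_coef0 f : K := f 0%N.

Fact fps_coef0_is_zmod_morphism : zmod_morphism fps_coef0.
Proof. by []. Qed.
Fact fps_coef0_is_monoid_morphism : monoid_morphism fps_coef0.
Proof. by split=> // f g; rewrite /fps_coef0 fpsME big_ord1. Qed.
HB.instance Definition _ := GRing.isZmodMorphism.Build (fps K) K
  fps_coef0 fps_coef0_is_zmod_morphism.
HB.instance Definition _ := GRing.isMonoidMorphism.Build (fps K) K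
  fps_coef0 fps_coef0_is_monoid_morphism.

End FpsRing.

Section FpsMap.
Variables (K K' : comNzRingType) (phi : {rmorphism K -> K'}).

Definition fps_map (f : fps K) : fps K' := Fps (fun m => phi (f m)).

Fact fps_map_is_zmod_morphism : zmod_morphism fps_map.
Proof. by move=> f g; apply: fpsP => m /=; rewrite rmorphB. Qed.
Fact fps_map_is_monoid_morphism : monoid_morphism fps_map.
Proof.
split; first by apply: fpsP => m /=; rewrite rmorph_nat.
move=> f g; apply: fpsP => m; rewrite fpsME /= rmorph_sum.
by apply: eq_bigr => i _; rewrite rmorphM.
Qed.
HB.instance Definition _ := GRing.isZmodMorphism.Build (fps K) (fps K')
  fps_map fps_map_is_zmod_morphism.
HB.instance Definition _ := GRing.isMonoidMorphism.Build (fps K) (fps K')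
  fps_map fps_map_is_monoid_morphism.

Lemma fps_map_poly (p : {poly K}) : fps_map (fps_poly p) = fps_poly (map_poly phi p).
Proof. by apply: fpsP => m /=; rewrite coef_map. Qed.

End FpsMap.

(** * Order of vanishing *)

Definition vanishes_below (K : nmodType) n (f : nat -> K) :=
  forall m, (m < n)%N -> f m = 0.

Section Vanishing.
Variable K : comNzRingType.
Implicit Types f g : fps K.

Lemma vanishes_belowM m n f g :
  vanishes_below m f -> vanishes_below n g -> vanishes_below (m + n) (f * g).
Proof.
move=> fm gn i imn; rewrite fpsME big1 // => j _; case: (ltnP j m) => jm.
  by rewrite fm // mul0r.
by rewrite gn ?mulr0 //; have := ltn_ord j; lia.
Qed.

Lemma fpsM_lead m n f g :
  vanishes_below m f -> vanishes_below n g -> (f * g) (m + n)%N = f m * g n.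
Proof.
move=> fm gn; have mlt : (m < (m + n).+1)%N by lia.
rewrite fpsME (bigD1 (Ordinal mlt)) //= addKn big1 ?addr0 // => j.
rewrite -val_eqE /= => jm; case: (ltngtP j m) jm => // jm _.
  by rewrite fm // mul0r.
by rewrite gn ?mulr0 //; have := ltn_ord j; lia.
Qed.

Lemma fps_prod_lead (I : finType) (f : I -> fps K) (o : I -> nat) :
  (forall i, vanishes_below (o i) (f i)) ->
  vanishes_below (\sum_i o i)%N (\prod_i f i) /\
  (\prod_i f i) (\sum_i o i)%N = \prod_i f i (o i).
Proof.
move=> f_low; elim/big_ind3: _ => // x n a y l b [xn xa] [yl yb]; split.
  exact: vanishes_belowM.
by rewrite fpsM_lead // xa yb.
Qed.

Lemma vanishes_belowX n f : f 0%N = 0 -> vanishes_below n (f ^+ n).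
Proof.
move=> f0; elim: n => // n IH; rewrite exprS -add1n.
by apply: vanishes_belowM IH; case.
Qed.

Lemma fpsXnM n f m : (fps_poly 'X^n * f) m = shiftS n f m.
Proof.
have Xn_low : vanishes_below n (fps_poly ('X^n : {poly K})).
  by move=> i i_n; rewrite /= coefXn ltn_eqF.
rewrite /shiftS; case: leqP => [nm|mn]; last first.
  by apply: (vanishes_belowM Xn_low (n := 0)); rewrite ?addn0.
have n_lt : (n < m.+1)%N by [].
rewrite fpsME (bigD1 (Ordinal n_lt)) //= coefXn eqxx mul1r big1 ?addr0 // => i.
by rewrite -val_eqE /= coefXn => /negPf ->; rewrite mul0r.
Qed.

Definition fps_drop n f : fps K := Fps (fun m => f (n + m)%N).

Lemma fps_dropK n f : vanishes_below n f -> fps_poly 'X^n * fps_drop n f = f.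
Proof.
move=> fn; apply: fpsP => m; rewrite fpsXnM /shiftS.
by case: leqP => [nm|/fn -> //]; rewrite /= subnKC.
Qed.

End Vanishing.

Lemma coef_unit_prod_XaddC (K : idomainType) (I : finType) (c : I -> K) (u : fps K) :
  u 0%N != 0 ->
  (u * fps_poly (\prod_i ('X + (c i)%:P))) #|[pred i | c i == 0]| != 0.
Proof.
move=> u0; have -> : \prod_i ('X + (c i)%:P) =
    'X^#|[pred i | c i == 0]| * \prod_(i | c i != 0) ('X + (c i)%:P).
  rewrite (bigID [pred i | c i == 0]) /= -prodr_const; congr (_ * _).
  by apply: eq_bigr => i /eqP ->; rewrite addr0.
rewrite rmorphM mulrCA fpsXnM /shiftS leqnn subnn fpsME big_ord1 /=.
rewrite mulf_neq0 // -horner_coef0 horner_prod.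
by apply/prodf_neq0 => i ci; rewrite !hornerE.
Qed.

Lemma fps_lreg (K : idomainType) (f : fps K) n :
  vanishes_below n f -> f n != 0 -> GRing.lreg f.
Proof.
move=> fn fn0; apply: mulrI0_lreg => g fg0; apply: fpsP.
elim/ltn_ind => m g_low; have := fpsM_lead fn g_low.
by rewrite fg0 => /esym/eqP; rewrite mulf_eq0 (negPf fn0) => /eqP.
Qed.

(** * Substitution of a series without constant term *)

Section Substitution.
Variables (K : comNzRingType) (h : fps K).
Hypothesis h0 : h 0%N = 0.

Lemma horner_low (p r : {poly (fps K)}) n :
  (forall i, (i < n)%N -> p`_i = r`_i) ->
  forall m, (m < n)%N -> p.[h] m = r.[h] m.
Proof.
move=> pr m mn; apply/eqP; rewrite -subr_eq0 -fpsBE -hornerN -hornerD.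
rewrite -(poly_take_drop n (p - r)) [take_poly _ _](_ : _ = 0).
  rewrite add0r hornerM hornerXn mulrC; apply/eqP.
  by apply: (vanishes_belowM (vanishes_belowX h0) (n := 0)); rewrite ?addn0.
by apply/polyP => i; rewrite coef_take_poly coef0; case: ltnP => // /pr;
   rewrite coefB => ->; rewrite subrr.
Qed.

Definition fps_horner (F : fps (fps K)) : fps K :=
  Fps (fun m => (fps_trunc m.+1 F).[h] m).

Lemma fps_horner_trunc F n m : (m < n)%N -> fps_horner F m = (fps_trunc n F).[h] m.
Proof.
move=> mn; apply: (@horner_low _ _ m.+1) => // i im.
by rewrite !coef_fps_trunc //; lia.
Qed.

Lemma fps_hornerM F G : fps_horner (F * G) = fps_horner F * fps_horner G.
Proof.
apply: fpsP => m.
transitivity ((fps_trunc m.+1 F * fps_trunc m.+1 G).[h] m).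
  apply: (@horner_low _ _ m.+1) => // i im.
  by rewrite coef_fps_trunc // -fps_mul_trunc.
rewrite hornerM; apply: eq_bigr => i _; rewrite !(@fps_horner_trunc _ m.+1) //.
by rewrite ltnS leq_subr.
Qed.

Lemma fps_horner_poly (p : {poly (fps K)}) : fps_horner (fps_poly p) = p.[h].
Proof.
apply: fpsP => m; apply: (@horner_low _ _ m.+1) => // i im.
by rewrite coef_fps_trunc.
Qed.

Lemma fps_horner_coef0 F : fps_horner F 0%N = F 0%N 0%N.
Proof. by rewrite /= horner_poly big_ord1 expr0 mulr1. Qed.

End Substitution.

(** * Convergent power series *)

Section WeightedNorm.
Variable K : realFieldType.
Implicit Types (f g : fps K) (p : {poly K}) (r s A B : K).

(* Bounding the partial sums expresses that the weighted norm
   [sum_m |f m| r^m] is at most [B] without forming the infinite sum. *)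
Definition wnorm_le r f B := forall n, \sum_(i < n) `|f i| * r ^+ i <= B.

Lemma wnorm_le_ge0 r f B : wnorm_le r f B -> 0 <= B.
Proof. by move=> /(_ 0%N); rewrite big_ord0. Qed.

Lemma wnorm_le_trans r f A B : wnorm_le r f A -> A <= B -> wnorm_le r f B.
Proof. by move=> fA AB n; apply: le_trans (fA n) AB. Qed.

Lemma wnorm_le_radius r s f B : 0 <= s <= r -> wnorm_le r f B -> wnorm_le s f B.
Proof.
move=> /andP[s0 sr] fB n; apply: le_trans (fB n); apply: ler_sum => i _.
by rewrite ler_wpM2l ?lerXn2r ?nnegrE // (le_trans s0).
Qed.

Lemma wnorm_le_coef r f B m : 0 <= r -> wnorm_le r f B -> `|f m| * r ^+ m <= B.
Proof.
move=> r0 /(_ m.+1); rewrite big_ord_recr /=; apply: le_trans.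
by rewrite lerDr sumr_ge0 // => i _; rewrite mulr_ge0 ?exprn_ge0.
Qed.

Lemma wnorm_leD r f g A B :
  0 <= r -> wnorm_le r f A -> wnorm_le r g B -> wnorm_le r (f + g) (A + B).
Proof.
move=> r0 fA gB n; apply: le_trans (lerD (fA n) (gB n)).
rewrite -big_split /=; apply: ler_sum => i _.
by rewrite -mulrDl ler_wpM2r ?exprn_ge0 ?ler_normD.
Qed.

Lemma wnorm_leN r f B : wnorm_le r f B -> wnorm_le r (- f) B.
Proof. by move=> fB n; under eq_bigr do rewrite normrN; exact: fB. Qed.

Lemma sum_coef_le_horner r p n :
  0 <= r -> (forall i, 0 <= p`_i) -> \sum_(i < n) p`_i * r ^+ i <= p.[r].
Proof.
move=> r0 p0; have p_ge0 i : 0 <= p`_i * r ^+ i by rewrite mulr_ge0 ?exprn_ge0.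
rewrite (horner_coef_wide _ (leq_maxr n (size p))).
rewrite -!(big_mkord xpredT (fun i => p`_i * r ^+ i)).
by rewrite [leRHS](big_cat_nat (n := n)) ?leq_maxl //= ler_wpDr // sumr_ge0.
Qed.

(* The partial sums of [f] and [g] are the values at [r] of the truncations of
   the series of absolute values, whose product dominates the partial sum of [f * g]. *)
Lemma wnorm_leM r f g A B :
  0 <= r -> wnorm_le r f A -> wnorm_le r g B -> wnorm_le r (f * g) (A * B).
Proof.
move=> r0 fA gB n.
pose abs_trunc (h : fps K) : {poly K} := \poly_(i < n) `|h i|.
have abs_truncE h : (abs_trunc h).[r] = \sum_(i < n) `|h i| * r ^+ i.
  exact: horner_poly.
have abs_trunc_ge0 h i : 0 <= (abs_trunc h)`_i by rewrite coef_poly; case: ifP.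
apply: (@le_trans _ _ (abs_trunc f * abs_trunc g).[r]); last first.
  rewrite hornerM !abs_truncE; apply: ler_pM; [| |exact: fA|exact: gB].
  - by apply: sumr_ge0 => i _; rewrite mulr_ge0 ?exprn_ge0.
  - by apply: sumr_ge0 => i _; rewrite mulr_ge0 ?exprn_ge0.
apply: le_trans (sum_coef_le_horner n r0 _) => [|i]; last first.
  by rewrite coefM sumr_ge0 // => j _; rewrite mulr_ge0.
apply: ler_sum => i _; rewrite ler_wpM2r ?exprn_ge0 // coefM fpsME.
apply: le_trans (ler_norm_sum _ _ _) _; apply: ler_sum => j _.
by rewrite normrM !coef_poly !ifT //; have := ltn_ord i; have := ltn_ord j; lia.
Qed.

Lemma wnorm_leC r c : wnorm_le r (fps_poly c%:P) `|c|.
Proof.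
case=> [|n]; first by rewrite big_ord0.
rewrite big_ord_recl big1 ?addr0 => [|i _]; last by rewrite /= coefC normr0 mul0r.
by rewrite /= coefC expr0 mulr1.
Qed.

Lemma wnorm_leX r : 0 <= r -> wnorm_le r (fps_poly 'X) r.
Proof.
move=> r0 [|[|n]]; first by rewrite big_ord0.
  by rewrite big_ord1 /= coefX normr0 mul0r.
rewrite 2!big_ord_recl big1 ?addr0 => [|i _]; last by rewrite /= coefX normr0 mul0r.
by rewrite /= !coefX normr0 mul0r add0r normr1 mul1r.
Qed.

End WeightedNorm.

Section Convergent.
Variable K : realFieldType.
Implicit Types (f g : fps K) (F : {poly (fps K)}).

Definition convfps : {pred fps K} :=
  fun f => `[< exists r B, 0 < r /\ wnorm_le r f B >].

Lemma convfps_common (l : seq (fps K)) : {subset l <= convfps} ->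
  exists r B, 0 < r /\ {in l, forall f, wnorm_le r f B}.
Proof.
elim: l => [_|f l IH fl]; first by exists 1, 0; split.
have [|r [B [r0 lB]]] := IH; first by move=> g gl; rewrite fl ?inE ?gl ?orbT.
have /asboolP[s [C [s0 fC]]] : f \in convfps by rewrite fl ?mem_head.
exists (Num.min r s), (Num.max B C); split=> [|g]; first by rewrite lt_min r0.
have min0 : 0 <= Num.min r s by rewrite le_min !ltW.
rewrite inE => /predU1P[->|/lB gB].
  apply: wnorm_le_trans (wnorm_le_radius _ fC) _; last by rewrite le_max lexx orbT.
  by rewrite min0 ge_min lexx orbT.
apply: wnorm_le_trans (wnorm_le_radius _ gB) _; last by rewrite le_max lexx.
by rewrite min0 ge_min lexx.
Qed.

Lemma convfps_common2 f g : f \in convfps -> g \in convfps ->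
  exists r B, [/\ 0 < r, wnorm_le r f B & wnorm_le r g B].
Proof.
move=> cf cg; have [|r [B [r0 fgB]]] := @convfps_common [:: f; g].
  by move=> h; rewrite !inE => /orP[] /eqP ->.
by exists r, B; split=> //; apply: fgB; rewrite !inE eqxx ?orbT.
Qed.

Lemma convfpsC c : fps_poly c%:P \in convfps.
Proof. by apply/asboolP; exists 1, `|c|; split=> //; exact: wnorm_leC. Qed.

Fact convfps_subring : subring_closed convfps.
Proof.
split=> [|f g cf cg|f g cf cg]; first by rewrite -(rmorph1 (@fps_poly K)) convfpsC.
- have [r [B [r0 fB gB]]] := convfps_common2 cf cg.
  apply/asboolP; exists r, (B + B); split=> //.
  by apply: wnorm_leD => //; [exact: ltW|exact: wnorm_leN].
- have [r [B [r0 fB gB]]] := convfps_common2 cf cg.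
  by apply/asboolP; exists r, (B * B); split=> //; apply: wnorm_leM => //; exact: ltW.
Qed.

HB.instance Definition _ := GRing.isSubringClosed.Build (fps K) convfps convfps_subring.

Lemma convfpsX : fps_poly 'X \in convfps.
Proof. by apply/asboolP; exists 1, 1; split=> //; exact: wnorm_leX. Qed.

Lemma convfps_poly (p : {poly K}) : fps_poly p \in convfps.
Proof.
elim/poly_ind: p => [|p c IH]; first by rewrite rmorph0 rpred0.
by rewrite rmorphD rmorphM rpredD ?rpredM ?convfpsX ?convfpsC.
Qed.

Lemma convfps_drop n f : f \in convfps -> fps_drop n f \in convfps.
Proof.
move=> /asboolP[r [B [r0 fB]]]; apply/asboolP; exists r, (r ^- n * B); split=> // m.
rewrite mulrC ler_pdivlMr ?exprn_gt0 // mulr_suml; apply: le_trans (fB (n + m)%N).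
rewrite big_split_ord /= ler_wpDl //.
  by apply: sumr_ge0 => i _; rewrite mulr_ge0 // exprn_ge0 // ltW.
by apply: ler_sum => i _; rewrite -mulrA -exprD addnC.
Qed.

Lemma wnorm_le_horner F (A : K) : F \is a polyOver convfps -> exists r C, 0 < r /\
  forall s w, 0 <= s <= r -> wnorm_le s w A -> wnorm_le s F.[w] C.
Proof.
move=> cF; have [|r [B [r0 FB]]] := @convfps_common F.
  by move=> f /(nthP 0)[i _ <-]; exact: (polyOverP cF).
suff [C hC] : exists C, forall s w, 0 <= s <= r -> wnorm_le s w A ->
    wnorm_le s (horner_rec F w) C by exists r, C.
elim: {cF} (polyseq F) FB => [|f l IH] flB /=.
  exists 0 => s w /andP[s0 _] _; rewrite -[0%R](rmorph0 (@fps_poly K)) -polyC0.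
  by apply: wnorm_le_trans (wnorm_leC _ _) _; rewrite normr0.
have [|C lC] := IH; first by move=> g gl; apply: flB; rewrite inE gl orbT.
exists (C * A + B) => s w sr wA; have /andP[s0 _] := sr.
apply: wnorm_leD => //; first by apply: wnorm_leM => //; exact: lC.
by apply: wnorm_le_radius sr (flB _ _); rewrite mem_head.
Qed.

End Convergent.

Arguments convfps {K}.

(** * Hensel's lemma for convergent power series *)

Section ContractionFixedPoint.
Variables (K : comNzRingType) (g : fps K -> fps K).
Local Notation approx n := (iter n g 0).

Definition xadic_contraction := forall n (v w : fps K),
  vanishes_below n (v - w) -> vanishes_below n.+1 (g v - g w).

(* The coefficient of [x^m] is final from the [m.+1]-st iterate on. *)
Definition fps_fixpoint : fps K := Fps (fun m => approx m.+1 m).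

Hypothesis g_contracts : xadic_contraction.

Lemma iter_contraction_step n : vanishes_below n (approx n.+1 - approx n).
Proof. by elim: n => [//|n IH]; exact: g_contracts. Qed.

Lemma fps_fixpoint_iter n : vanishes_below n (fps_fixpoint - approx n).
Proof.
move=> m /subnKC <-; apply/eqP; rewrite fpsBE subr_eq0; apply/eqP.
elim: (n - m.+1)%N => [|d ->]; first by rewrite addn0.
apply/esym/eqP; rewrite -subr_eq0 -fpsBE addnS; apply/eqP/iter_contraction_step; lia.
Qed.

Lemma fps_fixpointE : g fps_fixpoint = fps_fixpoint.
Proof.
apply: fpsP => m; apply/eqP; rewrite -subr_eq0; apply/eqP.
exact: (g_contracts (@fps_fixpoint_iter m)).
Qed.

End ContractionFixedPoint.

Lemma wnorm_le_fixpoint (K : realFieldType) (g : fps K -> fps K) (r B : K) :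
  xadic_contraction g -> 0 <= B -> (forall v, wnorm_le r v B -> wnorm_le r (g v) B) ->
  wnorm_le r (fps_fixpoint g) B.
Proof.
move=> g_contracts B0 g_le n.
have iter_le : wnorm_le r (iter n g 0) B.
  elim: n => [|n IH] /=; last exact: g_le.
  by move=> m; rewrite big1 // => i _; rewrite normr0 mul0r.
apply: le_trans (iter_le n); apply: ler_sum => i _.
have := fps_fixpoint_iter g_contracts (ltn_ord i).
by move/eqP; rewrite fpsBE subr_eq0 => /eqP ->.
Qed.

Lemma horner_diff (A : comNzRingType) (p : {poly A}) (a b : A) :
  exists e, p.[a] - p.[b] = (a - b) * e.
Proof.
elim/poly_ind: p => [|p c [e pe]]; first by exists 0; rewrite !horner0; ring.
exists (p.[a] + b * e); rewrite !hornerMXaddC.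
by rewrite mulrDr mulrCA -pe; ring.
Qed.

Lemma convfps_fixpoint (K : realFieldType) (G : {poly (fps K)}) (a : fps K) :
  G \is a polyOver convfps -> a \in convfps ->
  exists2 v, v \in convfps & v = a + fps_poly 'X * G.[v].
Proof.
move=> cG ca; pose g v := a + fps_poly 'X * G.[v].
have g_contracts : xadic_contraction g.
  move=> n v w vw; have [e GvGw] := horner_diff G v w.
  rewrite opprD addrACA subrr add0r -mulrBr GvGw -add1n.
  apply: vanishes_belowM; first by case=> //= _; rewrite coefX.
  by rewrite -[n]addn0; apply: vanishes_belowM.
exists (fps_fixpoint g); last by rewrite -/(g _) fps_fixpointE.
have /asboolP[r [A [r0 aA]]] := ca; have A0 := wnorm_le_ge0 aA.
have [s [C [s0 GC]]] := wnorm_le_horner (A + 1) cG.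
have C1 : 0 < `|C| + 1 by rewrite ltr_wpDl.
pose t := Num.min (Num.min r s) (`|C| + 1)^-1.
have t0 : 0 < t by rewrite !lt_min r0 s0 invr_gt0.
have tr : 0 <= t <= r by rewrite ltW //= !ge_min lexx.
have ts : 0 <= t <= s by rewrite ltW //= !ge_min lexx orbT.
have tC : t * C <= 1.
  apply: (@le_trans _ _ (t * (`|C| + 1))).
    by rewrite ler_wpM2l ?ltW // ltr_pwDr // ler_norm.
  by rewrite -ler_pdivlMr // mul1r ge_min lexx orbT.
apply/asboolP; exists t, (A + 1); split=> //.
apply: (wnorm_le_fixpoint g_contracts); first by rewrite addr_ge0.
move=> v vA; apply: (wnorm_le_trans (A := A + t * C)); last by rewrite lerD2l.
apply: wnorm_leD; rewrite ?ltW //; first exact: wnorm_le_radius aA.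
by apply: wnorm_leM; [exact: ltW|apply: wnorm_leX; exact: ltW|exact: GC].
Qed.

Lemma fps_split0 (K : comNzRingType) (f : fps K) :
  f = fps_poly (f 0%N)%:P + fps_poly 'X * fps_drop 1 f.
Proof.
have f_low : vanishes_below 1 (f - fps_poly (f 0%N)%:P).
  by case=> // _; rewrite fpsBE /= coefC subrr.
rewrite -[LHS](subrKC (fps_poly (f 0%N)%:P)) -{1}(fps_dropK f_low); congr (_ + _ * _).
by apply: fpsP => m; rewrite /= coefC subr0.
Qed.

(* With [w = x v], Taylor's formula turns [F.[w] = 0], after division by
   [x F'(0)(0)], into a fixed point equation for [v] that contracts x-adically. *)
Lemma hensel_at0 (K : realFieldType) (F : {poly (fps K)}) :
  F \is a polyOver convfps -> F`_0 0%N = 0 -> F`_1 0%N != 0 ->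
  exists2 w : fps K, w \in convfps & w 0%N = 0 /\ F.[w] = 0.
Proof.
move=> cF F0 d0; pose x : fps K := fps_poly 'X.
pose a := fps_drop 1 F`_0; pose b := fps_drop 1 F`_1; pose S := drop_poly 2 F.
pose d : fps K := fps_poly (F`_1 0%N)%:P; pose dV : fps K := fps_poly (F`_1 0%N)^-1%:P.
have ddV : d * dV = 1 by rewrite -rmorphM -polyCM mulfV ?rmorph1.
have FE v : F.[x * v] = x * (a + d * v + x * (b * v + v ^+ 2 * S.[x * v])).
  rewrite -{1}(poly_take_drop 2 F) hornerD hornerM hornerXn horner_poly !big_ord_recl.
  rewrite big_ord0 /= (fps_split0 F`_0) F0 rmorph0 add0r (fps_split0 F`_1).
  by rewrite -/x -/a -/b -/d -/S; ring.
have ca : a \in convfps by rewrite convfps_drop // (polyOverP cF).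
have cb : b \in convfps by rewrite convfps_drop // (polyOverP cF).
have cS : S \is a polyOver convfps.
  by apply/polyOverP => i; rewrite coef_drop_poly (polyOverP cF).
pose G := - dV%:P * (b%:P * 'X + 'X ^+ 2 * (S \Po (x%:P * 'X))).
have cG : G \is a polyOver convfps.
  rewrite rpredM ?rpredN ?rpredD ?rpredM ?rpredX ?polyOverX ?polyOverC ?convfps_poly //.
  by rewrite polyOver_comp // rpredM ?polyOverX ?polyOverC ?convfps_poly.
have [|v cv vE] := convfps_fixpoint cG (a := - dV * a).
  by rewrite rpredM ?rpredN ?convfps_poly.
exists (x * v); first by rewrite rpredM ?convfps_poly.
split; first by rewrite fpsME big_ord1 /= coefX mul0r.
suff -> : F.[x * v] = x * (a + x * (b * v + v ^+ 2 * S.[x * v])) * (1 - d * dV).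
  by rewrite ddV subrr mulr0.
rewrite FE [in d * v]vE /G.
by rewrite !(hornerM, hornerN, hornerD, hornerC, hornerX, hornerXn, horner_comp); ring.
Qed.

Lemma hensel (K : realFieldType) (F : {poly (fps K)}) (z : K)
    (r := map_poly (@fps_coef0 K) F) :
  F \is a polyOver convfps -> root r z -> ~~ root r^`() z ->
  exists2 w : fps K, w \in convfps & w 0%N = z /\ F.[w] = 0.
Proof.
move=> cF rz r'z; pose T := F \Po ('X + (fps_poly z%:P)%:P).
have coefT0 i : T`_i 0%N = (r \Po ('X + z%:P))`_i.
  rewrite -[LHS](coef_map (@fps_coef0 K)) map_comp_poly rmorphD /= map_polyX map_polyC.
  by rewrite /= /fps_coef0 coefC.
have [|||w cw [w0 Tw]] := @hensel_at0 _ T.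
- by rewrite polyOver_comp // rpredD ?polyOverX ?polyOverC ?convfps_poly.
- by rewrite coefT0 -horner_coef0 horner_comp !hornerE; exact/eqP.
- rewrite coefT0 -[_`_1]mulr1n -coef_deriv -horner_coef0 deriv_comp.
  by rewrite derivD derivX derivC addr0 mulr1 horner_comp !hornerE.
exists (w + fps_poly z%:P); first by rewrite rpredD ?convfps_poly.
split; first by rewrite fpsDE w0 add0r /= coefC.
by rewrite -Tw horner_comp !hornerE.
Qed.

Lemma poly_ext (R : numDomainType) (p r : {poly R}) :
  (forall x, p.[x] = r.[x]) -> p = r.
Proof.
move=> pr; apply/eqP; rewrite -subr_eq0; apply/eqP.
apply: (@roots_geq_poly_eq0 _ _ [seq n%:R | n <- iota 0 (size (p - r))]).
- by apply/allP => x _; rewrite rootE hornerD hornerN pr subrr.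
- by rewrite map_inj_uniq ?iota_uniq // => m n /eqP; rewrite eqr_nat => /eqP.
- by rewrite size_map size_iota.
Qed.

Lemma horner_fpsC_coef (K : comNzRingType) (F : {poly (fps K)}) (z : K) m :
  F.[fps_poly z%:P] m = (map_poly (fun f : fps K => f m) F).[z].
Proof.
rewrite horner_coef fps_sumE (horner_coef_wide _ (size_poly _ _)).
apply: eq_bigr => i _; rewrite coef_poly ltn_ord -rmorphXn -polyC_exp mulrC.
rewrite fpsME big_ord_recl /= coefC subn0 big1 ?addr0 1?mulrC // => j _.
by rewrite coefC mul0r.
Qed.

(* Writing [F.[y + e w] = x^N G.[w]], the polynomial [r] is the reduction of [G]
   modulo [x]. *)
Lemma hensel_along (K : realFieldType) (F : {poly (fps K)}) (y e : fps K) N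
    (r : {poly K}) (z : K) :
  F \is a polyOver convfps -> y \in convfps -> e \in convfps ->
  (forall c, vanishes_below N F.[y + e * fps_poly c%:P]) ->
  (forall c, F.[y + e * fps_poly c%:P] N = r.[c]) ->
  root r z -> ~~ root r^`() z ->
  exists2 w, w \in convfps & w 0%N = z /\ F.[y + e * w] = 0.
Proof.
move=> cF cy ce F_low F_lead rz rz'; pose Q := F \Po (y%:P + e%:P * 'X).
have QE w : Q.[w] = F.[y + e * w] by rewrite horner_comp !hornerE.
have Q_conv : Q \is a polyOver convfps.
  by rewrite polyOver_comp // rpredD ?rpredM ?polyOverX ?polyOverC.
have coefQ n m : Q`_n m = (map_poly (fun f : fps K => f m) Q)`_n.
  by rewrite coef_map_id0.
have Q_low n : vanishes_below N Q`_n.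
  move=> m mN; rewrite coefQ; suff -> : map_poly (fun f : fps K => f m) Q = 0.
    by rewrite coef0.
  by apply: poly_ext => c; rewrite -horner_fpsC_coef QE F_low // horner0.
have Q_lead n : Q`_n N = r`_n.
  suff <- : map_poly (fun f : fps K => f N) Q = r by rewrite coefQ.
  by apply: poly_ext => c; rewrite -horner_fpsC_coef QE F_lead.
pose G := map_poly (fps_drop N) Q.
have coefG n : G`_n = fps_drop N Q`_n by rewrite coef_map_id0 //; exact: fpsP.
have QG : Q = (fps_poly 'X^N)%:P * G.
  by apply/polyP => n; rewrite coefCM coefG fps_dropK.
have residueG : map_poly (@fps_coef0 K) G = r.
  by apply/polyP => n; rewrite coef_map coefG /= /fps_coef0 /= addn0 Q_lead.
have [|||w cw [w0 Gw]] := @hensel _ G z; rewrite ?residueG //.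
  by apply/polyOverP => n; rewrite coefG convfps_drop // (polyOverP Q_conv).
by exists w => //; split=> //; rewrite -QE QG hornerM Gw mulr0.
Qed.

(** * The Hermite-Biehler theorem *)

Section RealPart.
Variable R : rcfType.
Local Notation C := R[i].
Local Notation toC := (real_complex R).
Local Notation Re := (@complex.Re R).

Lemma ReMr (w : C) (x : R) : Re (w * toC x) = Re w * x.
Proof. by case: w => a b /=; ring. Qed.

Lemma Re_rotate (t : R) (w : C) :
  Re ((1 -i* t)%C * w) = Re w + t * complex.Im w.
Proof. by case: w => a b /=; ring. Qed.

Lemma Re_neq0 (w : C) : complex.Im w = 0 -> w != 0 -> Re w != 0.
Proof. by case: w => a b /= ->; rewrite eq_complex eqxx andbT. Qed.

Lemma map_ReMr (p : {poly C}) (r : {poly R}) :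
  map_poly Re (p * map_poly toC r) = map_poly Re p * r.
Proof.
apply/polyP => n; rewrite coef_map !coefM raddf_sum.
by apply: eq_bigr => i _; rewrite !coef_map /= ReMr.
Qed.

Lemma horner_map_Re (p : {poly C}) (x : R) :
  (map_poly Re p).[x] = Re p.[toC x].
Proof.
elim/poly_ind: p => [|p c IH]; first by rewrite raddf0 !horner0 raddf0.
rewrite raddfD /= map_polyC /= -['X](map_polyX toC) map_ReMr /= !hornerE IH.
by rewrite map_polyX !hornerE raddfD /= ReMr.
Qed.

Lemma horner_map2_Re (P : {poly {poly C}}) (h : {poly R}) :
  (map_poly (map_poly Re) P).[h] = map_poly Re P.[map_poly toC h].
Proof.
elim/poly_ind: P => [|P c IH]; first by rewrite raddf0 !horner0 raddf0.
have -> : map_poly (map_poly Re) (P * 'X + c%:P) =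
    map_poly (map_poly Re) P * 'X + (map_poly Re c)%:P.
  apply/polyP => n; rewrite coef_map /= !coefD !coefMX !coefC.
  by case: n => [|n] /=; rewrite ?add0r ?addr0 ?coef_map.
by rewrite !hornerMXaddC IH -map_ReMr raddfD.
Qed.

Lemma deriv_map_Re (p : {poly C}) : (map_poly Re p)^`() = map_poly Re p^`().
Proof. by apply/polyP => n; rewrite coef_deriv !coef_map coef_deriv raddfMn. Qed.

Lemma map_toC_Re (p : {poly C}) :
  map_poly toC (map_poly Re p) = 2^-1 *: (p + map_poly conjc p).
Proof.
by apply/polyP => n; rewrite coefZ coefD !coef_map /= addcJ mulKf ?pnatr_eq0.
Qed.

End RealPart.

Section HermiteBiehler.
Variable R : rcfType.
Local Notation C := R[i].
Local Notation toC := (real_complex R).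
Local Notation Re := (@complex.Re R).
Local Notation Im := (@complex.Im R).
Local Notation upper_half := (all (fun a => 0 < Im a)).
Implicit Types (p : {poly C}) (a c z : C) (x : R) (s : seq C).

(* [|p(x)|^2] times the derivative at [x] of the argument of [p]. *)
Definition arg_speed p x : R := Im (p^`().[toC x] * (p.[toC x])^*%C).

Lemma arg_speedM a p x : arg_speed ((a%:P - 'X) * p) x =
  ((Re a - x) ^+ 2 + Im a ^+ 2) * arg_speed p x +
  Im a * (Re p.[toC x] ^+ 2 + Im p.[toC x] ^+ 2).
Proof.
rewrite /arg_speed derivM derivB derivC derivX sub0r !hornerE.
by case: (p.[_]) (p^`().[_]) a => [p1 p2] [d1 d2] [a1 a2] /=; ring.
Qed.

Lemma simple_root_map_Re c p x (q := map_poly Re (c *: p)) :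
  c != 0 -> arg_speed p x != 0 -> root q x -> ~~ root q^`() x.
Proof.
rewrite /arg_speed {}/q deriv_map_Re !rootE !horner_map_Re derivZ !hornerZ.
case: (p.[_]) (p^`().[_]) c => [p1 p2] [d1 d2] [c1 c2].
rewrite eq_complex negb_and /= => c0 speed /eqP Re0; apply/negP => /eqP Re0'.
have : (c1 ^+ 2 + c2 ^+ 2) * (d1 * - p2 + d2 * p1) =
  (c1 * d2 + c2 * d1) * (c1 * p1 - c2 * p2) - (c1 * d1 - c2 * d2) * (c1 * p2 + c2 * p1).
  by ring.
rewrite Re0 Re0' mulr0 mul0r subrr => /eqP; rewrite mulf_eq0 (negPf speed) orbF.
by rewrite paddr_eq0 ?sqr_ge0 // !sqrf_eq0; apply/negP; rewrite negb_and.
Qed.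

(* Off the real axis, [2 Re(c p) = c p + conj(c) conj(p)] has two summands of
   different moduli. *)
Lemma root_map_Re_real c p z :
  (forall w, 0 < Im w -> `|p.[w]| < `|(map_poly conjc p).[w]|) -> c != 0 ->
  root (map_poly toC (map_poly Re (c *: p))) z -> Im z = 0.
Proof.
move=> norm_lt c0; set q := map_poly toC _.
have upper w : 0 < Im w -> ~~ root q w.
  move=> w0; apply/negP; rewrite rootE /q map_toC_Re.
  have -> : map_poly conjc (c *: p) = (c^*)%C *: map_poly conjc p.
    by rewrite -mul_polyC rmorphM /= map_polyC mul_polyC.
  rewrite !hornerE mulf_eq0 invr_eq0 pnatr_eq0 /= addr_eq0 => /eqP/(congr1 Num.norm).
  rewrite normrN !normrM normcJ => /mulfI normE.
  by have := norm_lt w w0; rewrite normE ?ltxx // normr_eq0.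
move=> qz; have qz' : root q (z^*)%C.
  rewrite rootE -(inj_eq (can_inj (@conjcK R))) -horner_map rmorph0 /= conjcK.
  by rewrite -map_poly_comp (eq_map_poly (@conjc_real R)).
have [z0|z0|//] := ltrgtP (Im z) 0; last by move: qz; rewrite (negPf (upper _ z0)).
have : 0 < Im (z^*)%C by case: (z) z0 => ? ? /=; rewrite oppr_gt0.
by move/upper; rewrite qz'.
Qed.

Lemma real_rooted_split (q : {poly R}) : q != 0 ->
  (forall z, root (map_poly toC q) z -> Im z = 0) ->
  (forall x, root q x -> ~~ root q^`() x) ->
  exists l : seq R, [/\ uniq l, size l = (size q).-1 & {in l, forall x, root q x}].
Proof.
move=> q0 q_real q_simple; have [l lE] := closed_field_poly_normal (map_poly toC q).
have lc0 : lead_coef (map_poly toC q) != 0 by rewrite lead_coef_eq0 map_poly_eq0.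
have rootl z : root (map_poly toC q) z = (z \in l).
  by rewrite lE rootZ // root_prod_XsubC.
have l_real z : z \in l -> toC (Re z) = z.
  by rewrite -rootl => /q_real; case: z => a b /= ->.
have rootR z : z \in l -> root q (Re z).
  by move=> zl; rewrite -(fmorph_root toC) /= l_real // rootl.
exists (map Re l); split=> [||_ /mapP[z zl ->]]; last exact: rootR.
- rewrite map_inj_in_uniq => [|z w zl wl zw]; last by rewrite -(l_real z) // zw l_real.
  have ql : map_poly toC q %= \prod_(z <- l) ('X - z%:P) by rewrite lE eqp_scale.
  rewrite -separable_prod_XsubC -(eqp_separable ql) unlock.
  apply: Pdiv.ClosedField.root_coprimep => z; rewrite rootl => zl.
  rewrite deriv_map -(l_real z zl) -rootE fmorph_root.
  exact/q_simple/rootR.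
- by rewrite size_map -(size_map_poly toC) lE size_scale // size_prod_XsubC.
Qed.

Definition prod_subX s : {poly C} := \prod_(a <- s) (a%:P - 'X).

Lemma coef_size_prod_subX s : (prod_subX s)`_(size s) = (-1) ^+ size s.
Proof.
have -> : prod_subX s = (-1) ^+ size s *: \prod_(a <- s) ('X - a%:P).
  rewrite /prod_subX; elim: s => [|a s IH]; first by rewrite !big_nil scale1r.
  rewrite !big_cons IH exprS -scalerA scaleN1r -scalerAr.
  by rewrite -['X - _]opprB mulNr scalerN opprK.
rewrite coefZ; have /monicP := monic_prod_XsubC s xpredT id.
by rewrite lead_coefE size_prod_XsubC => ->; rewrite mulr1.
Qed.

Lemma size_prod_subX s : size (prod_subX s) = (size s).+1.
Proof.
rewrite /prod_subX; elim: s => [|a s IH]; first by rewrite big_nil size_poly1.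
rewrite big_cons -opprB mulNr size_polyN size_mul ?polyXsubC_eq0 //; last first.
  by rewrite -size_poly_eq0 IH.
by rewrite IH size_XsubC.
Qed.

Lemma prod_subX_real_neq0 s x : upper_half s -> (prod_subX s).[toC x] != 0.
Proof.
move=> s_upper; rewrite horner_prod prodf_seq_neq0.
apply/allP => -[a b] /(allP s_upper) /= b0.
by rewrite !hornerE eq_complex negb_and /= oppr0 addr0 (gt_eqF b0) orbT.
Qed.

Lemma norm_prod_subX_lt s z : upper_half s -> s != [::] -> 0 < Im z ->
  `|(prod_subX s).[z]| < `|(map_poly conjc (prod_subX s)).[z]|.
Proof.
move=> s_upper s0 z0; rewrite /prod_subX rmorph_prod !horner_prod !normr_prod.
rewrite big_seq [ltRHS]big_seq; apply: ltr_prod => [|a /(allP s_upper) a0].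
  by case: s s0 {s_upper} => //= a l _; rewrite mem_head.
rewrite normr_ge0 rmorphB /= map_polyC map_polyX !hornerE !normc_def ltcR.
case: a z a0 z0 => a b [x y] /= b0 y0; have by0 : 0 < b * y by rewrite mulr_gt0.
rewrite ltr_sqrt; first by rewrite ltrD2l !expr2; lra.
by rewrite ltr_wpDl ?sqr_ge0 // exprn_even_gt0 //=; lra.
Qed.

Lemma arg_speed_prod_subX_gt0 s x :
  upper_half s -> s != [::] -> 0 < arg_speed (prod_subX s) x.
Proof.
suff: upper_half s -> 0 <= arg_speed (prod_subX s) x /\
    (s != [::] -> 0 < arg_speed (prod_subX s) x) by move=> speed /speed[].
elim: s => [_|a l IH /= /andP[a0 l_upper]].
  by rewrite /arg_speed /prod_subX big_nil derivC horner0 mul0r.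
have [speed0 _] := IH l_upper.
have speed_gt0 : 0 < arg_speed (prod_subX (a :: l)) x.
  rewrite /prod_subX big_cons arg_speedM ltr_wpDl ?mulr_ge0 ?addr_ge0 ?sqr_ge0 //.
  have := prod_subX_real_neq0 x l_upper; rewrite eq_complex negb_and /= => neq0.
  rewrite mulr_gt0 // lt_neqAle addr_ge0 ?sqr_ge0 // andbT eq_sym.
  by rewrite paddr_eq0 ?sqr_ge0 // !sqrf_eq0 negb_and.
by split=> [|_]; [exact: ltW|].
Qed.

Lemma size_map_Re_prod_subX s c :
  Re c != 0 -> size (map_poly Re (c *: prod_subX s)) = (size s).+1.
Proof.
move=> Re_c; apply/eqP; rewrite eqn_leq; apply/andP; split.
  rewrite (leq_trans (size_poly _ _)) // (leq_trans (size_scale_leq _ _)) //.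
  by rewrite size_prod_subX.
rewrite ltnNge; apply/negP => /leq_sizeP/(_ _ (leqnn _))/eqP; apply/negP.
rewrite coef_map coefZ /= coef_size_prod_subX -(rmorphN1 (real_complex R)) -rmorphXn /=.
by rewrite ReMr mulf_neq0 ?expf_neq0 // oppr_eq0 oner_eq0.
Qed.

Lemma hermite_biehler s c (q := map_poly Re (c *: prod_subX s)) :
  upper_half s -> Re c != 0 -> exists l : seq R, [/\ uniq l, size l = size s &
    {in l, forall x, root q x /\ ~~ root q^`() x}].
Proof.
move=> s_upper Re_c; have c0 : c != 0 by apply: contraNneq Re_c => ->.
have [s0|s_neq0] := eqVneq s [::]; first by exists [::]; rewrite s0.
have q_simple x : root q x -> ~~ root q^`() x.
  by apply: simple_root_map_Re => //; rewrite gt_eqF // arg_speed_prod_subX_gt0.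
have [|z||l [l_uniq l_size l_root]] := @real_rooted_split q.
- by rewrite -size_poly_eq0 size_map_Re_prod_subX.
- by apply: root_map_Re_real => // w w0; exact: norm_prod_subX_lt.
- exact: q_simple.
exists l; split=> // [|x xl]; first by rewrite l_size size_map_Re_prod_subX.
by have := l_root x xl; split=> //; exact: q_simple.
Qed.

End HermiteBiehler.

(** * Splitting off roots *)

Section FactorRoots.
Variables (A : comNzRingType) (S : subringClosed A).

Lemma polyOver_divXsubC (p : {poly A}) y : p \is a polyOver S -> y \in S ->
  exists2 s, s \is a polyOver S & p = s * ('X - y%:P) + p.[y]%:P.
Proof.
move=> pS yS; elim/poly_ind: p pS => [_|p c IH pS].
  by exists 0; rewrite ?rpred0 // mul0r horner0 addr0.
have pS' : p \is a polyOver S.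
  apply/polyOverP => i; have /polyOverP/(_ i.+1) := pS.
  by rewrite coefD coefMX coefC /= addr0.
have [s sS pE] := IH pS'.
exists (s * 'X + p.[y]%:P).
  by rewrite rpredD ?rpredM ?polyOverX ?polyOverC // rpred_horner.
by rewrite hornerMXaddC {1}pE rmorphD rmorphM /=; ring.
Qed.

Lemma polyOver_factor_roots (I : finType) (p : {poly A}) (y : I -> A) :
  p \is a polyOver S -> (forall i, y i \in S) -> (forall i, root p (y i)) ->
  (forall i j, i != j -> GRing.lreg (y i - y j)) ->
  exists2 s, s \is a polyOver S & p = s * \prod_i ('X - (y i)%:P).
Proof.
move=> pS yS py yreg; rewrite -big_enum /=.
elim: (enum I) (enum_uniq I) => [_|i l IH /= /andP[il /IH[s sS pE]]].
  by exists p; rewrite ?big_nil ?mulr1.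
have si : s.[y i] = 0.
  have := py i; rewrite pE rootE hornerM; elim: l il {IH pE} => [_|j l IH].
    by rewrite big_nil hornerE mulr1 => /eqP.
  rewrite inE negb_or => /andP[ij /IH{}IH]; rewrite big_cons hornerM mulrCA.
  by rewrite hornerXsubC mulrI_eq0 //; exact: yreg.
have [s' s'S sE] := polyOver_divXsubC sS (yS i).
exists s' => //; rewrite big_cons {1}pE {1}sE si addr0; ring.
Qed.

End FactorRoots.

(** * Series in two variables *)

Section TwoVariables.
Variables (R : realType) (K : comNzRingType) (phi : {rmorphism K -> R[i]}).
Implicit Types (F G : fps (fps K)).

(* [F] is a series in [y] whose coefficients are series in [x]. *)
Definition ser2_of F : ser2 R := fun m n => phi (F n m).

Lemma ser2_ofM F G : ser2_of (F * G) = mulS (ser2_of F) (ser2_of G).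
Proof.
apply/funext => m; apply/funext => n; rewrite /ser2_of /mulS fpsME fps_sumE rmorph_sum.
rewrite exchange_big; apply: eq_bigr => j _; rewrite fpsME rmorph_sum.
by apply: eq_bigr => i _; rewrite rmorphM.
Qed.

Lemma ser2_of1 : ser2_of 1 = oneS R.
Proof.
apply/funext => m; apply/funext => n; rewrite /ser2_of /oneS fps1E.
by case: (n == 0%N); rewrite ?andbT ?andbF /= ?rmorph0 // rmorph_nat.
Qed.

Lemma ser2_of_lin (h : fps K) :
  ser2_of (fps_poly ('X + h%:P)) = lin1 (fun m => phi (h m)).
Proof.
apply/funext => m; apply/funext => n.
rewrite /ser2_of /lin1 /= coefD coefX coefC; case: n => [|[|n]] /=.
- by rewrite add0r.
- by rewrite addr0 rmorph_nat.
- by rewrite addr0 rmorph0.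
Qed.

Lemma ser2_of_prod (I : finType) (F : fps (fps K)) (h : I -> fps K) :
  ser2_of (F * fps_poly (\prod_i ('X + (h i)%:P))) =
  mulS (ser2_of F) (\big[@mulS R/oneS R]_i lin1 (fun m => phi (h i m))).
Proof.
rewrite ser2_ofM rmorph_prod (big_morph ser2_of ser2_ofM ser2_of1).
by under eq_bigr do rewrite ser2_of_lin.
Qed.

End TwoVariables.

Lemma ser2_of_id_inj (R : realType) : injective (ser2_of (R := R) idfun).
Proof.
move=> F G FG; apply: fpsP => n; apply: fpsP => m.
exact: (congr1 (fun f : ser2 R => f m n) FG).
Qed.

Lemma conv2_ser2_of (R : realType) (S : {poly (fps R)}) : S \is a polyOver convfps ->
  conv2 (ser2_of (real_complex R) (fps_poly S)).
Proof.
move=> cS; have [|r [B [r0 SB]]] := @convfps_common _ S.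
  by move=> f /(nthP 0)[i _ <-]; exact: (polyOverP cS).
exists (Num.min r 1), (Num.max B 0); split=> [|m n]; first by rewrite lt_min r0 ltr01.
set s := Num.min r 1; have s0 : 0 <= s by rewrite le_min ltW /=.
have sr : 0 <= s <= r by rewrite s0 ge_min lexx.
rewrite /ser2_of /= -rmorphXn normc_def /= expr0n addr0 sqrtr_sqr -rmorphM lecR /=.
have [nS|Sn] := ltnP n (size S); last first.
  by rewrite nth_default // normr0 mul0r le_max lexx orbT.
rewrite exprD mulrA le_max; apply/orP; left.
have coef_le := wnorm_le_coef m s0 (wnorm_le_radius sr (SB _ (mem_nth 0 nS))).
apply: le_trans coef_le; rewrite ler_piMr ?mulr_ge0 ?exprn_ge0 //.
by rewrite exprn_ile1 // ge_min lexx orbT.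
Qed.

(** * Contact of branches *)

Section Contact.
Variable R : realType.

(* [(q, L)] stands for the branches [y + q(x) + x^(2L) w(x) = 0]. *)
Definition branch_data : Type := ({poly R} * nat)%type.
Implicit Types d e : branch_data.

Definition contact d e : nat := Oij d.1 e.1 d.2 e.2.

Lemma contactP d e (O := contact d e) :
  [/\ (O <= 2 * d.2)%N, (O <= 2 * e.2)%N,
      vanishes_below O (fun m => (e.1 - d.1)`_m) &
      (O < 2 * d.2)%N -> (O < 2 * e.2)%N -> (e.1 - d.1)`_O != 0].
Proof.
rewrite {}/O /contact /Oij; case: eqP => [->|/eqP q0].
  by split; [lia|lia|move=> m _; rewrite coef0|lia].
set o := ordp _; have o_neq0 : (e.1 - d.1)`_o != 0.
  apply: (@nth_find _ 0 (fun c => c != 0)); apply/(has_nthP 0).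
  exists (size (e.1 - d.1)).-1; last by rewrite -lead_coefE lead_coef_eq0.
  by rewrite ltn_predL lt0n size_poly_eq0.
split; [lia|lia| |].
  move=> m m_lt; have : (m < o)%N by lia.
  by move=> /(@before_find _ 0 (fun c => c != 0)) /negbFE/eqP.
by move=> oi oj; have -> : minn o (minn (2 * e.2) (2 * d.2)) = o by lia.
Qed.

Lemma contactC d e : contact d e = contact e d.
Proof.
suff contact_le d1 d2 : (contact d1 d2 <= contact d2 d1)%N.
  by apply/eqP; rewrite eqn_leq !contact_le.
have [le1 le2 low _] := contactP d1 d2; have [_ _ _ lead] := contactP d2 d1.
rewrite leqNgt; apply/negP => lt; have := lead (leq_trans lt le2) (leq_trans lt le1).
by rewrite -opprB coefN oppr_eq0 low ?eqxx.
Qed.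

Lemma contact_self d : contact d d = (2 * d.2)%N.
Proof. by rewrite /contact /Oij subrr eqxx minnn. Qed.

Definition reduced_data d := (size d.1 <= 2 * d.2)%N.

Lemma contact_full d e : reduced_data d -> reduced_data e ->
  contact d e = (2 * d.2)%N -> contact d e = (2 * e.2)%N -> e = d.
Proof.
rewrite /reduced_data => sz sze Od Oe; have [_ _ low _] := contactP d e.
have de : e.2 = d.2 by lia.
apply/eqP; rewrite -pair_eqE /pair_eq de eqxx andbT -subr_eq0.
apply/eqP/polyP => m; rewrite coef0; case: (ltnP m (2 * d.2)) => [|dm].
  by rewrite -Od; exact: low.
by rewrite coefB !nth_default ?subrr ?(leq_trans sz) ?(leq_trans sze) ?de.
Qed.

(* [refines e d]: the branches [e] lie on [y + d.1(x) + c x^(2 d.2) + ... = 0]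
   with [c = contact_shift d e] real. *)
Definition refines e d := (e != d) && (contact d e == 2 * d.2)%N.
Definition contact_shift d e : R := (e.1 - d.1)`_(2 * d.2).

Section BranchSeries.
Variables (K : comNzRingType) (phi : {rmorphism R -> K}).

Definition branch_series k d (w : fps K) : fps K :=
  Fps (addS1 (substk1 k (fun m => phi d.1`_m)) (shiftS (2 * d.2 * k) w)).

Lemma branch_seriesE k d w : (0 < k)%N -> branch_series k d w =
  fps_poly (map_poly phi d.1 \Po 'X^k) + fps_poly 'X^(2 * d.2 * k) * w.
Proof.
move=> k0; apply: fpsP => m; rewrite fpsDE fpsXnM /= coef_comp_poly_Xn //.
by rewrite /addS1 /substk1; case: ifP; rewrite ?coef_map.
Qed.

Definition contact_coef d e (a b : K) : K :=
  phi (e.1 - d.1)`_(contact d e) + (if contact d e == 2 * e.2 then b else 0)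
    - (if contact d e == 2 * d.2 then a else 0).

Lemma branch_series_contact k d e w w'
    (diff := branch_series k e w' - branch_series k d w) : (0 < k)%N ->
  vanishes_below (contact d e * k) diff /\
  diff (contact d e * k)%N = contact_coef d e (w 0%N) (w' 0%N).
Proof.
move=> k0; have [Od Oe low _] := contactP d e.
have diffE m : diff m = (if (k %| m)%N then phi (e.1 - d.1)`_(m %/ k)%N else 0) +
    shiftS (2 * e.2 * k) w' m - shiftS (2 * d.2 * k) w m.
  by rewrite fpsBE /= /addS1 /substk1 coefB; case: ifP => _; rewrite ?rmorphB; ring.
have shift_lead N (v : fps K) : (contact d e <= N)%N ->
    shiftS (N * k) v (contact d e * k)%N = if contact d e == N then v 0%N else 0.
  move=> ON; rewrite /shiftS leq_pmul2r // eqn_leq ON /=.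
  by case: leqP => // NO; have -> : N = contact d e by [lia]; rewrite subnn.
split=> [m mO|]; last by rewrite diffE dvdn_mull // mulnK // !shift_lead.
rewrite diffE low ?ltn_divLR // rmorph0 if_same add0r /shiftS !ifN ?subr0 //.
  by rewrite -ltnNge; apply: leq_trans mO _; rewrite leq_pmul2r.
by rewrite -ltnNge; apply: leq_trans mO _; rewrite leq_pmul2r.
Qed.

Lemma contact_coef_self d a b : contact_coef d d a b = b - a.
Proof. by rewrite /contact_coef contact_self eqxx subrr coef0 rmorph0 add0r. Qed.

Lemma contact_coef_refines d e a b : reduced_data d -> reduced_data e ->
  refines e d -> contact_coef d e a b = phi (contact_shift d e) - a.
Proof.
move=> rd re /andP[ed /eqP Od]; rewrite /contact_coef Od eqxx ifN ?addr0 //.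
by apply: contra ed => /eqP Oe; apply/eqP/contact_full => //; rewrite Od.
Qed.

Lemma contact_coef_coarse d e a a' b :
  e != d -> ~~ refines e d -> contact_coef d e a b = contact_coef d e a' b.
Proof. by rewrite /refines /contact_coef => -> /negPf /= ->. Qed.

Lemma contact_coef_neq0 d e a b : reduced_data d -> reduced_data e ->
  (e = d -> a != b) ->
  (refines e d -> a != phi (contact_shift d e)) ->
  (refines d e -> b != phi (contact_shift e d)) -> contact_coef d e a b != 0.
Proof.
move=> rd re ab ref ref'; have [ed|ed] := eqVneq e d.
  by rewrite ed contact_coef_self subr_eq0 eq_sym ab.
have [e_ref|e_coarse] := boolP (refines e d).
  by rewrite contact_coef_refines // subr_eq0 eq_sym ref.
move: e_coarse; rewrite /refines ed /contact_coef /= => Od; rewrite (negPf Od) subr0.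
have [Oe|Oe] := eqVneq (contact d e) (2 * e.2)%N.
  rewrite Oe -[e.1 - d.1]opprB coefN rmorphN addrC subr_eq0 ref' // /refines.
  by rewrite eq_sym ed contactC Oe eqxx.
have [leO leO' _ lead] := contactP d e.
by rewrite addr0 fmorph_eq0 lead // ltn_neqAle ?Od ?Oe.
Qed.

End BranchSeries.

Lemma branch_series1E (K : comNzRingType) (phi : {rmorphism R -> K}) d (w : fps K) m :
  branch_series phi 1 d w m = phi d.1`_m + shiftS (2 * d.2) w m.
Proof. by rewrite /= /addS1 /substk1 dvd1n divn1 muln1. Qed.

End Contact.

(** * Lowest coefficients along a branch *)

Section LowestCoefficient.
Variables (R : realType) (I : finType) (d : I -> branch_data R) (alpha : I -> R[i]).
Local Notation C := R[i].
Local Notation toC := (real_complex R).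
Hypothesis d_reduced : forall j, reduced_data (d j).
Hypothesis alpha_upper : forall j, 0 < complex.Im (alpha j).
Variable e : branch_data R.
Hypothesis e_reduced : reduced_data e.

Definition coarse_const : C :=
  \prod_(j | (d j != e) && ~~ refines (d j) e) contact_coef toC e (d j) 0 (alpha j).
Definition fibre_values : seq C := [seq alpha j | j <- enum [pred j | d j == e]].
Definition refining_poly : {poly R} :=
  \prod_(j | refines (d j) e) ((contact_shift e (d j))%:P - 'X).

Lemma prod_contact_coef z :
  \prod_j contact_coef toC e (d j) (toC z) (alpha j) =
  (coarse_const *: prod_subX fibre_values).[toC z] * toC refining_poly.[z].
Proof.
rewrite (bigID [pred j | d j == e]) /=.
rewrite (bigID [pred j | refines (d j) e] (fun j => ~~ _)) /=.
have -> : \prod_(j | d j == e) contact_coef toC e (d j) (toC z) (alpha j) =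
    (prod_subX fibre_values).[toC z].
  rewrite /prod_subX big_map big_enum horner_prod.
  by apply: eq_bigr => j /eqP ->; rewrite contact_coef_self !hornerE.
have -> : \prod_(j | (d j != e) && refines (d j) e)
    contact_coef toC e (d j) (toC z) (alpha j) = toC refining_poly.[z].
  rewrite horner_prod rmorph_prod; apply: eq_big => [j|j /andP[_ d_ref]].
    by rewrite /refines andbA andbb.
  by rewrite contact_coef_refines // !hornerE rmorphB.
have -> : \prod_(j | (d j != e) && ~~ refines (d j) e)
    contact_coef toC e (d j) (toC z) (alpha j) = coarse_const.
  by apply: eq_bigr => j /andP[de d_coarse]; exact: contact_coef_coarse.
by rewrite hornerZ; ring.
Qed.

Lemma fibre_values_upper : all (fun a => 0 < complex.Im a) fibre_values.
Proof. by apply/allP => _ /mapP[j _ ->]. Qed.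

(* The first value controls the degree of the Hermite-Biehler factor of the real
   part, the others its values at the roots of [refining_poly]. *)
Definition critical_values : seq C := coarse_const ::
  [seq coarse_const * (prod_subX fibre_values).[toC (contact_shift e (d j))] | j : I].

Lemma critical_values_neq0 : 0 \notin critical_values.
Proof.
have coarse_neq0 : coarse_const != 0.
  rewrite prodf_seq_neq0; apply/allP => j _; apply/implyP => /andP[de d_coarse].
  apply: contact_coef_neq0 => // [dj_e|dj_ref|_]; first by rewrite dj_e eqxx in de.
    by rewrite dj_ref in d_coarse.
  by apply: contraTneq (alpha_upper j) => ->; rewrite ltxx.
rewrite inE negb_or eq_sym coarse_neq0; apply/negP => /mapP[j _ /esym/eqP].
by apply/negP; rewrite mulf_neq0 // prod_subX_real_neq0 // fibre_values_upper.
Qed.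

End LowestCoefficient.

(** * Convergent branches of the real part *)

Definition ramify (K : comNzRingType) k (P : {poly {poly K}}) : {poly (fps K)} :=
  map_poly (@fps_poly K) (map_poly (comp_poly 'X^k) P).

Lemma coef_ramify (K : comNzRingType) k (P : {poly {poly K}}) m n : (0 < k)%N ->
  (ramify k P)`_n m = if (k %| m)%N then P`_n`_(m %/ k) else 0.
Proof. by move=> k0; rewrite /ramify !coef_map /= coef_comp_poly_Xn. Qed.

Lemma horner_ramify (K : comNzRingType) k (P : {poly {poly K}}) (h : {poly K}) :
  (ramify k P).[fps_poly (h \Po 'X^k)] = fps_poly (P.[h] \Po 'X^k).
Proof.
by rewrite /ramify horner_map; congr fps_poly; exact: (horner_map (comp_poly 'X^k)).
Qed.

Definition re_series (R : realType) (P : {poly {poly R[i]}}) : {poly (fps R)} :=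
  map_poly (@fps_poly R) (map_poly (map_poly (@complex.Re R)) P).

Lemma coef_re_series (R : realType) (P : {poly {poly R[i]}}) m n :
  (re_series P)`_n m = complex.Re P`_n`_m.
Proof. by rewrite /re_series !coef_map /= !coef_map. Qed.

Lemma horner_re_series (R : realType) (P : {poly {poly R[i]}}) (h : {poly R}) :
  (re_series P).[fps_poly h] =
  fps_poly (map_poly (@complex.Re R) P.[map_poly (real_complex R) h]).
Proof. by rewrite /re_series horner_map horner_map2_Re. Qed.

Lemma re_series_conv (R : realType) (P : {poly {poly R[i]}}) :
  re_series P \is a polyOver convfps.
Proof. by apply/polyOverP => n; rewrite coef_map convfps_poly. Qed.

Lemma fibrewise_injective_choice (I : finType) (D A : eqType) (a0 : A)
    (f : I -> D) (Q : D -> A -> Prop) :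
  (forall i, exists l : seq A, [/\ uniq l, size l = #|[pred j | f j == f i]| &
    {in l, forall a, Q (f i) a}]) ->
  exists z : I -> A, (forall i, Q (f i) (z i)) /\
    (forall i j, f i = f j -> z i = z j -> i = j).
Proof.
move=> exl; have /choice[l lP] : forall d, exists l : seq A, d \in codom f ->
    [/\ uniq l, size l = #|[pred j | f j == d]| & {in l, forall a, Q d a}].
  move=> d; have [/codomP[i ->]|] := boolP (d \in codom f); last by exists [::].
  by have [l lP] := exl i; exists l.
pose fibre i := enum [pred j | f j == f i]; pose pos i := index i (fibre i).
have mem_fibre i : i \in fibre i by rewrite mem_enum inE.
have pos_lt i : (pos i < size (l (f i)))%N.
  by have [_ -> _] := lP _ (codom_f f i); rewrite cardE index_mem.
exists (fun i => nth a0 (l (f i)) (pos i)); split=> [i|i j fij].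
  by have [_ _] := lP _ (codom_f f i); apply; exact: mem_nth.
have [l_uniq _ _] := lP _ (codom_f f j); have := pos_lt i; rewrite fij => pos_i.
move/eqP; rewrite nth_uniq // => /eqP pos_ij.
rewrite -(nth_index i (mem_fibre i)) -/(pos i) pos_ij /fibre fij.
by rewrite (nth_index i (mem_fibre j)).
Qed.

Section Branches.
Variables (R : realType) (I : finType) (d : I -> branch_data R) (psi : I -> fps R[i]).
Variables (k : nat) (P : {poly {poly R[i]}}) (U : fps (fps R[i])).
Local Notation C := R[i].
Local Notation toC := (real_complex R).
Local Notation Re := (@complex.Re R).
Hypothesis k_gt0 : (0 < k)%N.
Hypothesis d_reduced : forall j, reduced_data (d j).
Hypothesis d0 : forall j, (d j).1.[0] = 0.
Hypothesis psi_upper : forall j, 0 < complex.Im (psi j 0%N).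
Hypothesis P_low : forall n, (n < #|I|)%N -> P`_n`_0 = 0.
Hypothesis U0 : U 0%N 0%N != 0.
Hypothesis P_factors : fps_poly (ramify k P) =
  U * fps_poly (\prod_j ('X + (branch_series toC k (d j) (psi j))%:P)).

(* On [x = 0] the factor of an index with [L = 0] is a unit, so that [P(0,y)]
   would have order less than the number of factors. *)
Lemma exponent_gt0 j : (0 < (d j).2)%N.
Proof.
pose c i : C := if (d i).2 == 0%N then psi i 0%N else 0.
have series0 i : branch_series toC k (d i) (psi i) 0%N = c i.
  rewrite /= /addS1 /substk1 dvdn0 div0n -horner_coef0 d0 rmorph0 add0r /shiftS.
  by rewrite leqn0 !muln_eq0 (gtn_eqF k_gt0) orbF.
have P_at0 : fps_map (@fps_coef0 C) (fps_poly (ramify k P)) =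
    fps_map (@fps_coef0 C) U * fps_poly (\prod_i ('X + (c i)%:P)).
  rewrite P_factors rmorphM /= fps_map_poly rmorph_prod.
  congr (_ * fps_poly _); apply: eq_bigr => i _.
  by rewrite rmorphD /= map_polyX map_polyC /= [X in X%:P]series0.
have := coef_unit_prod_XaddC c (U0 : fps_map (@fps_coef0 C) U 0%N != 0).
rewrite -P_at0 /= /fps_coef0 coef_ramify // dvdn0 div0n lt0n; apply: contra => /eqP Lj0.
rewrite P_low //; apply/proper_card/properP; split; first exact/subsetP.
exists j; rewrite // inE /c Lj0 /=.
by apply: contraTneq (psi_upper j) => ->; rewrite ltxx.
Qed.

Lemma branch_expansion (e : branch_data R) (z : R) (N := (\sum_j contact e (d j))%N)
    (h := map_poly toC (- e.1 - z *: 'X^(2 * e.2))) :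
  (0 < e.2)%N -> e.1.[0] = 0 ->
  vanishes_below N (fun m => P.[h]`_m) /\
  P.[h]`_N = U 0%N 0%N * \prod_j contact_coef toC e (d j) (toC z) (psi j 0%N).
Proof.
move=> e_gt0 e0; pose hs : fps C := fps_poly (h \Po 'X^k).
have hsE : hs = - branch_series toC k e (fps_poly (toC z)%:P).
  have hE : h = - map_poly toC e.1 - (toC z)%:P * 'X^(2 * e.2).
    by rewrite /h rmorphB rmorphN -mul_polyC rmorphM /= map_polyC map_polyXn.
  rewrite branch_seriesE // /hs hE opprD -rmorphM -!rmorphN -rmorphD /=; congr fps_poly.
  rewrite rmorphB rmorphN rmorphM /= comp_polyC comp_Xn_poly -exprM.
  by rewrite [(k * _)%N]mulnC mulrC.
have hs0 : hs 0%N = 0.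
  rewrite hsE fpsNE /= /addS1 /substk1 dvdn0 div0n -horner_coef0 e0 rmorph0 add0r.
  by rewrite /shiftS leqn0 !muln_eq0 !gtn_eqF // oppr0.
have PE : fps_poly (P.[h] \Po 'X^k) = fps_horner hs U *
    \prod_j (branch_series toC k (d j) (psi j)
              - branch_series toC k e (fps_poly (toC z)%:P)).
  rewrite -horner_ramify -fps_horner_poly // P_factors fps_hornerM //.
  rewrite fps_horner_poly // horner_prod; congr (_ * _); apply: eq_bigr => j _.
  by rewrite hornerD hornerX hornerC -/hs hsE addrC.
have diff_order j :=
  branch_series_contact toC e (d j) (fps_poly (toC z)%:P) (psi j) k_gt0.
have [prod_low prod_lead] := fps_prod_lead (fun j => (diff_order j).1).
have U_low : vanishes_below 0 (fps_horner hs U) by [].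
rewrite -big_distrl /= -/N in prod_low prod_lead.
have coefP m : P.[h]`_m = fps_poly (P.[h] \Po 'X^k) (m * k)%N.
  by rewrite /= coef_comp_poly_Xn // dvdn_mull // mulnK.
split=> [m mN|]; rewrite coefP PE.
  by apply: (vanishes_belowM U_low prod_low); rewrite add0n ltn_pmul2r.
rewrite -[(N * k)%N]add0n fpsM_lead // prod_lead fps_horner_coef0; congr (_ * _).
by apply: eq_bigr => j _; apply: etrans (diff_order j).2 _; rewrite /= coefC.
Qed.

(* [z] is the constant term of a convergent branch of the real part of [P] with
   data [e], whose contact with the finer branches of [P] is exactly [2 * e.2]. *)
Definition admissible (e : branch_data R) (z : R) : Prop :=
  (exists2 w, w \in convfps &
     w 0%N = z /\ root (re_series P) (- branch_series idfun 1 e w)) /\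
  forall j, refines (d j) e -> z != contact_shift e (d j).

Section AlongBranch.
Variable e : branch_data R.
Hypothesis e_reduced : reduced_data e.
Hypothesis e_gt0 : (0 < e.2)%N.
Hypothesis e0 : e.1.[0] = 0.
Local Notation alpha := (fun j => psi j 0%N).
Local Notation hb_factor :=
  (map_poly Re ((U 0%N 0%N * coarse_const d alpha e) *:
                  prod_subX (fibre_values d alpha e))).

Lemma re_branch_expansion (c : R) (N := (\sum_j contact e (d j))%N)
    (f := (re_series P).[fps_poly (- e.1) +
                           fps_poly (- 'X^(2 * e.2)) * fps_poly c%:P]) :
  vanishes_below N f /\ f N = (hb_factor * refining_poly d e).[c].
Proof.
have -> : f = fps_poly (map_poly Re P.[map_poly toC (- e.1 - c *: 'X^(2 * e.2))]).
  by rewrite /f -rmorphM -rmorphD horner_re_series mulNr mulrC mul_polyC.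
have [low lead] := branch_expansion c e_gt0 e0.
split=> [m mN|]; first by rewrite /= coef_map low // raddf0.
rewrite /= coef_map lead prod_contact_coef //.
by rewrite mulrA /= ReMr hornerM horner_map_Re !hornerZ mulrA.
Qed.

Hypothesis e_generic :
  {in critical_values d alpha e, forall v, Re (U 0%N 0%N * v) != 0}.

Lemma exists_admissible : exists l : seq R,
  [/\ uniq l, size l = #|[pred j | d j == e]| & {in l, forall z, admissible e z}].
Proof.
have coarse_generic : Re (U 0%N 0%N * coarse_const d alpha e) != 0.
  by apply: e_generic; rewrite mem_head.
have [l [l_uniq l_size l_root]] :=
  hermite_biehler (fibre_values_upper d psi_upper e) coarse_generic.
exists l; split=> // [|z /l_root[z_root z_simple]].
  by rewrite l_size size_map -cardE.
have z_shift j : z != contact_shift e (d j).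
  apply: contraTneq z_root => ->; rewrite rootE horner_map_Re hornerZ -mulrA.
  by apply: e_generic; rewrite inE; apply/orP; right; apply/imageP; exists j.
split=> //; have refining_neq0 : (refining_poly d e).[z] != 0.
  rewrite horner_prod prodf_seq_neq0; apply/allP => j _; apply/implyP => _.
  by rewrite !hornerE subr_eq0 eq_sym.
have [||||w cw [w0 Fw]] := hensel_along (re_series_conv P) _ _
    (fun c => (re_branch_expansion c).1) (fun c => (re_branch_expansion c).2) (z := z).
- exact: convfps_poly.
- exact: convfps_poly.
- by rewrite rootM z_root.
- rewrite rootE derivM hornerD !hornerM (eqP z_root) mul0r addr0.
  by rewrite mulf_neq0.
exists w => //; split=> //; rewrite rootE -[X in _ == X]Fw branch_seriesE //.
by rewrite map_poly_id // comp_polyXr muln1 opprD -mulNr -!rmorphN.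
Qed.

End AlongBranch.

Local Notation series j w := (branch_series idfun 1 (d j) w).
Hypothesis P_generic : forall i, {in critical_values d (fun j => psi j 0%N) (d i),
  forall v, Re (U 0%N 0%N * v) != 0}.

Lemma exists_separated_roots : exists w : I -> fps R,
  [/\ forall j, w j \in convfps, forall j, root (re_series P) (- series j (w j)) &
   forall i j, i != j ->
     has_order (series j (w j) - series i (w i)) (contact (d i) (d j))].
Proof.
have [z [z_root z_inj]] := fibrewise_injective_choice 0
  (fun i => exists_admissible (d_reduced i) (exponent_gt0 i) (d0 i) (@P_generic i)).
have /choice[w wP] : forall j, exists w, [/\ w \in convfps, w 0%N = z j &
    root (re_series P) (- series j w)].
  by move=> j; have [[w cw [w0 w_root]] _] := z_root j; exists w.
exists w; split=> [j|j|i j ij]; [by have [] := wP j|by have [] := wP j|].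
have [_ wi0 _] := wP i; have [_ wj0 _] := wP j.
have [low lead] := branch_series_contact idfun (d i) (d j) (w i) (w j) (ltn0Sn 0).
rewrite muln1 in low lead; split; first exact: low.
rewrite lead wi0 wj0; apply: contact_coef_neq0 => // [dji|dj_ref|di_ref].
- by apply: contra ij => /eqP/z_inj ->.
- exact: (z_root i).2.
- exact: (z_root j).2.
Qed.

Lemma re_series_factorization : exists S (w : I -> fps R),
  [/\ S \is a polyOver convfps, forall j, w j \in convfps,
   re_series P = S * \prod_j ('X + (series j (w j))%:P) &
   forall i j, i != j ->
     has_order (series j (w j) - series i (w i)) (contact (d i) (d j))].
Proof.
have [w [cw w_root w_order]] := exists_separated_roots.
have series_conv j : - series j (w j) \in convfps.
  by rewrite rpredN branch_seriesE // rpredD ?rpredM ?convfps_poly.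
have [|S cS PE] := polyOver_factor_roots (re_series_conv P) series_conv w_root.
  move=> i j ij; have [low lead] := w_order i j ij.
  by rewrite opprK addrC; exact: fps_lreg low lead.
exists S, w; split=> //; rewrite PE; congr (_ * _).
by apply: eq_bigr => j _; rewrite polyCN opprK.
Qed.

End Branches.

Lemma coef0_cofactor (K : comNzRingType) (I : finType) (S : {poly (fps K)})
    (y : I -> fps K) : (forall i, y i 0%N = 0) ->
  (S * \prod_i ('X + (y i)%:P))`_#|I| 0%N = S`_0 0%N.
Proof.
move=> y0; rewrite -[LHS](coef_map (@fps_coef0 K)) rmorphM rmorph_prod /=.
rewrite (eq_bigr (fun=> 'X)) => [|i _]; last first.
  by rewrite rmorphD /= map_polyX map_polyC [X in X%:P]y0 addr0.
by rewrite prodr_const coefMXn ltnn subnn coef_map.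
Qed.

Lemma fps_factors_of_ser2 (R : realType) (I : finType) (k : nat)
    (P : {poly {poly R[i]}}) (u : ser2 R) (h : I -> fps R[i]) : (0 < k)%N ->
  substk2 k (polyS2 P) = mulS (substk2 k u) (\big[@mulS R/oneS R]_j lin1 (h j)) ->
  fps_poly (ramify k P) =
    Fps (fun n => Fps (fun m => substk2 k u m n)) * fps_poly (\prod_j ('X + (h j)%:P)).
Proof.
move=> k_gt0 P_factors; apply: ser2_of_id_inj; rewrite ser2_of_prod.
apply: etrans P_factors; apply/funext => m; apply/funext => n.
by rewrite /ser2_of /= coef_ramify.
Qed.

Lemma re_part_factorization (R : realType) (I : finType) (d : I -> branch_data R)
    (psi : I -> fps R[i]) (k : nat) (P : {poly {poly R[i]}}) (u : ser2 R) :
  (0 < k)%N -> (forall j, reduced_data (d j)) -> (forall j, (d j).1.[0] = 0) ->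
  (forall j, 0 < complex.Im (psi j 0%N)) ->
  (forall n, (n < #|I|)%N -> P`_n`_0 = 0) -> u 0%N 0%N != 0 ->
  substk2 k (polyS2 P) = mulS (substk2 k u)
    (\big[@mulS R/oneS R]_j lin1 (branch_series (real_complex R) k (d j) (psi j))) ->
  (forall i, {in critical_values d (fun j => psi j 0%N) (d i),
     forall v, complex.Re (u 0%N 0%N * v) != 0}) ->
  complex.Re P`_#|I|`_0 != 0 ->
  exists (v : ser2 R) (w : I -> ser1 R),
    [/\ unit2 v, forall j, conv1R (w j),
     (fun m n => (complex.Re P`_n`_m)%:C%C) = mulS v (\big[@mulS R/oneS R]_j
       lin1 (addS1 (polyS1 (d j).1) (realS (shiftS (2 * (d j).2) (w j))))) &
     forall i j, i != j -> has_order
       (fun m => ((d j).1 - (d i).1)`_m + shiftS (2 * (d j).2) (w j) m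
                   - shiftS (2 * (d i).2) (w i) m) (contact (d i) (d j))].
Proof.
move=> k_gt0 d_reduced d0 psi_upper P_low u0 /(fps_factors_of_ser2 k_gt0).
set U := Fps _ => P_factors generic P_lead.
have U0 : U 0%N 0%N = u 0%N 0%N by rewrite /= /substk2 dvdn0 div0n.
rewrite -U0 in u0 generic.
have [S [w [cS cw PE w_order]]] := re_series_factorization k_gt0 d_reduced d0
  psi_upper P_low u0 P_factors generic.
have series0 j : branch_series idfun 1 (d j) (w j) 0%N = 0.
  have := exponent_gt0 k_gt0 d0 psi_upper P_low u0 P_factors j.
  by rewrite branch_series1E -horner_coef0 d0 add0r /shiftS; case: (d j).2.
exists (ser2_of (real_complex R) (fps_poly S)), (fun j => w j); split=> [|j||i j ij].
- split; first exact: conv2_ser2_of.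
  by rewrite /ser2_of fmorph_eq0 /= -(coef0_cofactor S series0) -PE coef_re_series.
- have /asboolP[r [B [r0 wB]]] := cw j.
  by exists r, B; split=> // m; exact: wnorm_le_coef (ltW r0) wB.
- transitivity (ser2_of (real_complex R) (fps_poly (re_series P))).
    by apply/funext => m; apply/funext => n; rewrite /ser2_of /= coef_re_series.
  rewrite PE rmorphM ser2_of_prod; congr mulS; apply: eq_bigr => j _; congr lin1.
  by apply/funext => m; rewrite branch_series1E rmorphD.
- have [low lead] := w_order i j ij.
  have series_diff m : (branch_series idfun 1 (d j) (w j)
      - branch_series idfun 1 (d i) (w i)) m =
      ((d j).1 - (d i).1)`_m + shiftS (2 * (d j).2) (w j) m
        - shiftS (2 * (d i).2) (w i) m.
    by rewrite fpsBE !branch_series1E coefB /=; ring.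
  by split=> [m mO|]; rewrite -series_diff; [exact: low|exact: lead].
Qed.

(** * The pencil A + tB *)

Lemma rotate_off_imaginary_axis (R : realType) (s : seq R[i]) : 0 \notin s ->
  exists F : seq R, forall t, t \notin F ->
    {in s, forall w, complex.Re ((1 -i* t)%C * w) != 0}.
Proof.
move=> s0; exists [seq - complex.Re w / complex.Im w | w <- s] => t tF w ws.
have w0 : w != 0 by apply: contraNneq s0 => <-.
apply: contra tF => /eqP Re0; apply/mapP; exists w => //.
rewrite Re_rotate in Re0; have Im_w : complex.Im w != 0.
  apply: contraNneq w0 => Im0; apply/eqP; move: Re0; rewrite Im0 mulr0 addr0.
  by case: (w) Im0 => a b /= -> ->.
have -> : complex.Re w = - (t * complex.Im w) by lra.
by rewrite opprK mulfK.
Qed.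

Lemma critical_values_generic (R : realType) (I : finType) (d : I -> branch_data R)
    (alpha : I -> R[i]) (c : R[i]) :
  (forall j, reduced_data (d j)) -> (forall j, 0 < complex.Im (alpha j)) -> c != 0 ->
  exists F : seq R, forall t, t \notin F ->
    forall i, {in critical_values d alpha (d i), forall v,
      complex.Re ((1 -i* t)%C * c * v) != 0}.
Proof.
move=> d_reduced alpha_upper c0.
pose s := [seq c * v | v <- flatten [seq critical_values d alpha (d i) | i : I]].
have [|F F_generic] := @rotate_off_imaginary_axis R s.
  apply/mapP => -[v /flatten_mapP[i _ v_crit] /esym/eqP]; apply/negP.
  rewrite mulf_neq0 //; apply: contraTneq v_crit => ->.
  exact: critical_values_neq0.
exists F => t /F_generic t_generic i v v_crit; rewrite -mulrA.
by apply/t_generic/map_f/flatten_mapP; exists i; rewrite ?mem_enum.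
Qed.

Lemma coef_pencil (R : realType) (P : {poly {poly R[i]}}) (t : R) m n :
  (Apart P + cstP (t%:C)%C * Bpart P)`_n`_m =
  ((complex.Re ((1 -i* t)%C * P`_n`_m))%:C)%C.
Proof.
have i_neq0 : 'i%C != 0 :> R[i] by rewrite eq_complex /= negb_and oner_eq0 orbT.
rewrite /Apart /Bpart /cstP !(coefD, coefCM, coefN) /conjP !coef_map /=.
rewrite addcJ subcJ mulKf ?pnatr_eq0 //.
have -> : (2 * 'i%C)^-1 * (2 * (complex.Im P`_n`_m)%:C%C * 'i%C) =
    (complex.Im P`_n`_m)%:C%C by field; rewrite i_neq0.
by rewrite Re_rotate rmorphD rmorphM.
Qed.

Lemma substk2_mulSZ (R : realType) k c (P : {poly {poly R[i]}}) (u g : ser2 R) :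
  substk2 k (polyS2 P) = mulS (substk2 k u) g ->
  substk2 k (polyS2 (cstP c * P)) = mulS (substk2 k (fun m n => c * u m n)) g.
Proof.
move=> P_factors; apply/funext => m; apply/funext => n.
have := congr1 (fun f : ser2 R => c * f m n) P_factors; rewrite /mulS mulr_sumr.
rewrite /substk2 /polyS2 /cstP !coefCM [c * (if _ then _ else _)]fun_if mulr0 => ->.
apply: eq_bigr => i _; rewrite mulr_sumr; apply: eq_bigr => j _.
by case: ifP => _; rewrite ?mul0r ?mulr0 ?mulrA.
Qed.

Theorem theorem3p5 (R : realType) (P : {poly {poly R[i]}}) (M k : nat)
    (u : ser2 R) (L : 'I_M -> nat) (q : 'I_M -> {poly R})
    (psi : 'I_M -> ser1 R[i]) :
  (* P has no zeros in R x H *)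
  (forall (a : R) (b : R[i]), 0 < complex.Im b -> eval2 P ((a%:C)%C) b != 0) ->
  (* P and \bar P have no common (non-unit) factor *)
  (forall Q S1 S2 : {poly {poly R[i]}},
      P = Q * S1 -> conjP P = Q * S2 -> exists c : R[i], Q = cstP c) ->
  (* M = Ord P(0,y) *)
  has_order (fun n => (P`_n).[0]) M ->
  (* normalization: the coefficient of y^M in P(0,y) is real *)
  complex.Im ((P`_M)`_0) = 0 ->
  (* the factorization data of the context *)
  (0 < k)%N ->
  unit2 u ->
  (forall j, (q j).[0] = 0) ->
  (forall j, (size (q j) <= 2 * L j)%N) ->
  (forall j, conv1 (psi j) /\ 0 < complex.Im (psi j 0%N)) ->
  (* P(s^k,y) = u(s^k,y) prod_j (y + q_j(s^k) + s^(2 L_j k) psi_j(s)) *)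
  substk2 k (polyS2 P) =
    mulS (substk2 k u)
      (\big[@mulS R/oneS R]_(j < M)
          lin1 (addS1 (substk1 k (polyS1 (q j))) (shiftS (2 * L j * k) (psi j)))) ->
  exists F : seq R, forall t : R, t \notin F ->
    exists (ut : ser2 R) (psit : 'I_M -> ser1 R),
      [/\ unit2 ut,
          (forall j, conv1R (psit j)),
          polyS2 (Apart P + cstP ((t%:C)%C) * Bpart P) =
            mulS ut (\big[@mulS R/oneS R]_(j < M)
                       lin1 (addS1 (polyS1 (q j)) (realS (shiftS (2 * L j) (psit j))))) &
          forall i j : 'I_M, i != j ->
            has_order (fun m => (q j - q i)`_m + shiftS (2 * L j) (psit j) m
                                 - shiftS (2 * L i) (psit i) m)
                      (Oij (q i) (q j) (L i) (L j))].
Proof.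
move=> _ _ [P_low P_lead] P_real k_gt0 [_ u0] q0 size_q psiP P_factors.
have psi_upper j : 0 < complex.Im (psi j 0%N) by have [] := psiP j.
pose d j : branch_data R := (q j, L j).
have d_reduced j : reduced_data (d j) by exact: size_q.
have [F F_generic] := critical_values_generic d_reduced psi_upper u0.
exists F => t /F_generic t_generic; pose c := (1 -i* t)%C.
have c_neq0 : c != 0 by rewrite eq_complex /= oner_eq0.
have [||||v [w [v_unit w_conv P_eq w_order]]] := re_part_factorization (d := d)
  (psi := fun j => Fps (psi j)) k_gt0 d_reduced q0 psi_upper _ _
  (substk2_mulSZ c P_factors).
- by move=> n; rewrite card_ord !coefCM -horner_coef0 => /P_low ->; rewrite mulr0.
- by rewrite mulf_neq0.
- exact: t_generic.
- rewrite card_ord !coefCM Re_rotate P_real mulr0 addr0.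
  by apply: Re_neq0; rewrite // -horner_coef0.
exists v, w; split=> //; rewrite -P_eq; apply/funext => m; apply/funext => n.
by rewrite /polyS2 coef_pencil /cstP !coefCM.
Qed.
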